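(* Let $\mathcal U$ be a quasi-definite vector of linear functionals, $\{\mathcal B_m\}_{m\in\mathbb N}$ a vector sequence of polynomials, $\{\mathcal B_m^{(1)}\}_{m\in\mathbb N}$ its sequence of associated polynomials of the first kind (for $\mathcal U$), and $\mathcal F$ the generalized Markov matrix function of $\mathcal U$. Let $\{V_m\}$ be the matrix polynomials with $\mathcal B_m(x)=V_m(h(x))\mathcal P_0(x)$. Then $\{\mathcal B_m\}_{m\in\mathbb N}$ is left-orthogonal with respect to $\mathcal U$ if and only if, for every $m\in\mathbb N$, $$V_{m+1}(z)\mathcal F(z)-\mathcal B^{(1)}_m(z)=\Delta_{m+1}\frac1{z^{m+2}}+\cdots,$$ where $\Delta_{m+1}$ is a non-singular upper triangular matrix and the dots denote a series in the powers $z^{-n}$, $n\ge m+3$.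
   Context: $N\ge1$ is a fixed integer, $\mathbb N=\{0,1,2,\dots\}$, $h$ is a fixed polynomial of degree $N$, $\mathbb P$ is the space of polynomials, $\mathbb P^N$ the space of column vectors of $N$ polynomials. $\mathcal P_0(x)=[1\;x\;\cdots\;x^{N-1}]^T$ and $\mathcal P_j(x)=h(x)^j\mathcal P_0(x)$. A vector of linear functionals is $\mathcal U=[u^1\cdots u^N]^T$ with $u^j:\mathbb P\to\mathbb R$ linear; it acts on $\mathcal P=[p_1\cdots p_N]^T\in\mathbb P^N$ by the matrix $\mathcal U(\mathcal P)$ whose $(i,j)$ entry is $\langle u^j,p_i\rangle$ ($\mathcal U_x$ indicates action on the variable $x$), and $(h^k\mathcal U)(\mathcal P):=\mathcal U(h^k\mathcal P)$. $\mathcal U$ is quasi-definite if all leading principal submatrices of the block Hankel matrices $[\mathcal U(\mathcal P_{i+j})]_{i,j=0}^m$, $m\in\mathbb N$, are non-singular. A vector sequence of polynomials is $\mathcal B_m=[p_{mN}\;p_{mN+1}\cdots p_{(m+1)N-1}]^T$, where $\{p_n\}$ are scalar polynomials with $\deg p_n=n$; then $\mathcal B_m(x)=V_m(h(x))\mathcal P_0(x)$ for a unique $N\times N$ matrix polynomial $V_m$, of degree $m$. $\{\mathcal B_m\}$ is left-orthogonal with respect to $\mathcal U$ if, for all $m\in\mathbb N$, $(h^k\mathcal U)(\mathcal B_m)=0_{N\times N}$ for $k=0,\dots,m-1$ and $(h^m\mathcal U)(\mathcal B_m)=\Delta_m$ is a non-singular upper triangular matrix. The associated polynomials of the first kind are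 $$\mathcal B^{(1)}_m(z)=\mathcal U_x\!\left(\frac{V_{m+1}(z)-V_{m+1}(h(x))}{z-h(x)}\,\mathcal P_0(x)\right).$$ The generalized Markov matrix function is $\mathcal F(z)=\mathcal U_x\big(\mathcal P_0(x)/(z-h(x))\big)$, for $z$ with $|h(x)|<|z|$ for every $x\in\bigcup_{j}\operatorname{supp}u^j$, the action of $\mathcal U$ being understood through the expansion $\mathcal F(z)=\sum_{n=0}^\infty\mathcal U(h^n\mathcal P_0)\,z^{-n-1}$.
   Formalization: The condition that U(B_0) be upper triangular is added to the asymptotic side, since the display does not involve B_0 and the ''if'' direction fails for N ≥ 2 (replace p_1 by p_1 + c p_0, c ≠ 0); F and the expansion are read as formal series in 1/z. *)

(* Defs.v *)
From HB Require Import structures.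
From mathcomp Require Import all_boot all_order all_algebra.
From mathcomp Require Import reals.

Set Implicit Arguments.
Unset Strict Implicit.
Unset Printing Implicit Defensive.

Import Order.TTheory GRing.Theory Num.Theory.
Local Open Scope ring_scope.

Section VectorFunctionals.
Variables (R : realType) (N : nat).

(* [x] is 'X, and 'X^i is indexed from 0, so this is [1 x ... x^(N-1)]^T. *)
Definition P0 : 'cV[{poly R}]_N := \col_i 'X^i.

Definition Pvec (h : {poly R}) (j : nat) : 'cV[{poly R}]_N := h ^+ j *: P0.

(* The row index comes from the polynomials, the column index from the
   functionals. *)
Definition vact (U : 'I_N -> {scalar {poly R}}) (P : 'cV[{poly R}]_N) : 'M[R]_N :=
  \matrix_(i, j) U j (P i 0).

Definition hankel (h : {poly R}) (U : 'I_N -> {scalar {poly R}}) (m : nat) :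
    'M[R]_(\sum_(i < m.+1) N) :=
  \mxblock_(i < m.+1, j < m.+1) vact U (Pvec h (i + j)).

Definition leading_principal (n k : nat) (le_kn : (k <= n)%N) (A : 'M[R]_n) :
    'M[R]_k :=
  mxsub (widen_ord le_kn) (widen_ord le_kn) A.

Definition quasi_definite (h : {poly R}) (U : 'I_N -> {scalar {poly R}}) : Prop :=
  forall (m k : nat) (le_k : (k <= \sum_(i < m.+1) N)%N),
    leading_principal le_k (hankel h U m) \in unitmx.

Definition vector_sequence (B : nat -> 'cV[{poly R}]_N) : Prop :=
  exists p : nat -> {poly R},
    (forall n, size (p n) = n.+1) /\
    (forall m, B m = \col_(i < N) p (m * N + i)%N).

(* [is_trig_mx] is lower triangularity. *)
Definition upper_triangular (A : 'M[R]_N) : bool := is_trig_mx A^T.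

Definition left_orthogonal (h : {poly R}) (U : 'I_N -> {scalar {poly R}})
    (B : nat -> 'cV[{poly R}]_N) : Prop :=
  forall m : nat,
    (forall k : nat, (k < m)%N -> vact U (h ^+ k *: B m) = 0) /\
    (upper_triangular (vact U (h ^+ m *: B m)) /\
     vact U (h ^+ m *: B m) \in unitmx).

(* V(h(x)) *)
Definition mx_comp (V : 'M[{poly R}]_N) (h : {poly R}) : 'M[{poly R}]_N :=
  map_mx (fun q => q \Po h) V.

(* {poly {poly R}} is R[x][z]: the outer variable is z, the inner one is x.
   The divisor z - h(x) is monic in z, so %/ is Euclidean division, and it is
   exact because the dividend vanishes at z = h(x). *)
Definition divided_diff (V : 'M[{poly R}]_N) (h : {poly R}) :
    'M[{poly {poly R}}]_N :=
  map_mx (fun q : {poly R} => (q^:P - (q \Po h)%:P) %/ ('X - h%:P)) V.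

(* U_x on vectors of polynomials in z and x: each functional acts on the
   x-coefficients and leaves z alone. *)
Definition vact_x (U : 'I_N -> {scalar {poly R}}) (P : 'cV[{poly {poly R}}]_N) :
    'M[{poly R}]_N :=
  \matrix_(i, j) map_poly (U j) (P i 0).

(* First-kind associated polynomial built from V = V_(m+1). *)
Definition associated (h : {poly R}) (U : 'I_N -> {scalar {poly R}})
    (V : 'M[{poly R}]_N) : 'M[{poly R}]_N :=
  vact_x U (divided_diff V h *m map_mx polyC P0).

(* A matrix Laurent series in 1/z is given by its coefficients: [G e] is the
   coefficient of z^e, for e : int. *)
Definition mxlaurent : Type := int -> 'M[R]_N.

(* [Negz n] is the exponent -(n+1), so this is
   F(z) = \sum_n U(h^n P_0) z^(-n-1). *)
Definition markov (h : {poly R}) (U : 'I_N -> {scalar {poly R}}) : mxlaurent :=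
  fun e => if e is Negz n then vact U (h ^+ n *: P0) else 0.

Definition laurent_of_mxpoly (V : 'M[{poly R}]_N) : mxlaurent :=
  fun e => if e is Posz n then map_mx (coefp n) V else 0.

Definition mxpoly_size (V : 'M[{poly R}]_N) : nat :=
  \max_(ij : 'I_N * 'I_N) size (V ij.1 ij.2).

Definition mul_mxpoly_laurent (V : 'M[{poly R}]_N) (G : mxlaurent) : mxlaurent :=
  fun e => \sum_(k < mxpoly_size V) map_mx (coefp k) V *m G (e - k%:Z).

Definition sub_laurent (G H : mxlaurent) : mxlaurent := fun e => G e - H e.

(* G(z) = D z^(-n) + (a series in the powers z^(-k), k >= n+1) *)
Definition leading_term (G : mxlaurent) (n : nat) (D : 'M[R]_N) : Prop :=
  G (- n%:Z) = D /\ forall e : int, - n%:Z < e -> G e = 0.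

End VectorFunctionals.

Arguments P0 {R N}.

(* Main.v *)
Require Import Defs.
From HB Require Import structures.
From mathcomp Require Import all_boot all_order all_algebra.
From mathcomp Require Import reals.

Import Order.TTheory GRing.Theory Num.Theory.
Local Open Scope ring_scope.

(** Write [V(z) = \sum_k V_k z^k], let [B = V(h) P0], and let [A] be the
    associated polynomial of [V].  Constant matrices come out on the left of
    the action of [U], that is [U(V_k P) = V_k U(P)] ([vact_mulC]), and this
    gives all the coefficients of [V(z) F(z)].

    The coefficient of [z^(-n-1)] is
    [\sum_k V_k U(h^(n+k) P0) = U(h^n V(h) P0) = U(h^n B)]
    ([mul_markov_neg]).  The coefficient of [z^n] for [n >= 0] is
    [\sum_(k > n) V_k U(h^(k-n-1) P0)], and by the geometric factorization of
    [z^k - h^k] this is also the coefficient of [z^n] in [A]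
    ([coef_associated], [mul_markov_pos]).  So subtracting [A] from [V F]
    removes the polynomial part and leaves [\sum_n U(h^n B) z^(-n-1)] for any
    [V], orthogonal or not.

    Hence, for [B = B_(m+1)], having leading term [D z^(-m-2)] says exactly that
    [U(h^k B_(m+1))] vanishes for [k <= m] and equals [D] for [k = m+1]
    ([leading_term_remainderP]).  With [D] upper triangular and non-singular,
    this is left-orthogonality at the positive indices.  At index [0] the
    triangularity of [U(B_0)] is on both sides, and its non-singularity is
    automatic: [B_0 = L P0] with [L] lower triangular with nonzero diagonal, and
    [U(P0)] is a leading principal submatrix of a block Hankel matrix
    ([vact_vector_sequence0_unit]). *)

Section VectorAction.
Variables (R : realType) (N : nat) (h : {poly R}).
Variable (U : 'I_N -> {scalar {poly R}}).
Implicit Types (V : 'M[{poly R}]_N) (P : 'cV[{poly R}]_N).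

Lemma vact_sum (I : Type) (r : seq I) (p : pred I) (F : I -> 'cV[{poly R}]_N) :
  vact U (\sum_(i <- r | p i) F i) = \sum_(i <- r | p i) vact U (F i).
Proof.
apply/matrixP=> i j; rewrite mxE !summxE raddf_sum /=.
by apply: eq_bigr => k _; rewrite mxE.
Qed.

Lemma vact_mulC (A : 'M[R]_N) P :
  vact U (map_mx polyC A *m P) = A *m vact U P.
Proof.
apply/matrixP=> i j; rewrite !mxE raddf_sum /=.
by apply: eq_bigr => k _; rewrite !mxE mul_polyC linearZ.
Qed.

Lemma coef_vact_x n (P : 'cV[{poly {poly R}}]_N) :
  map_mx (coefp n) (vact_x U P) = vact U (map_mx (coefp n) P).
Proof.
by apply/matrixP=> i j; rewrite !mxE /= coef_map_id0 // raddf0.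
Qed.

Lemma leq_mxpoly_size V i j : (size (V i j) <= mxpoly_size V)%N.
Proof. exact: (leq_bigmax (i, j)). Qed.

Lemma comp_poly_wide (q : {poly R}) K : (size q <= K)%N ->
  q \Po h = \sum_(k < K) q`_k *: h ^+ k.
Proof.
move=> leqK; rewrite comp_polyE (big_ord_widen K (fun k => q`_k *: h ^+ k)) //.
rewrite big_mkcond; apply: eq_bigr => k _; case: ltnP => // le_k.
by rewrite nth_default ?scale0r.
Qed.

Lemma mx_compE V :
  mx_comp V h =
  \sum_(k < mxpoly_size V) map_mx polyC (map_mx (coefp k) V) *m (h ^+ k)%:M.
Proof.
apply/matrixP=> i j; rewrite summxE mxE.
rewrite (comp_poly_wide _ _ (leq_mxpoly_size V i j)).
by apply: eq_bigr => k _; rewrite mul_mx_scalar !mxE mulrC mul_polyC.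
Qed.

Lemma subXn_polyC k :
  'X^k - (h ^+ k)%:P = ('X - h%:P) * \poly_(i < k) h ^+ (k - i.+1).
Proof.
rewrite rmorphXn /= subrXX poly_def; congr (_ * _).
rewrite (reindex_inj rev_ord_inj); apply: eq_bigr => i _ /=.
rewrite -mul_polyC rmorphXn [RHS]mulrC; congr ('X^_ * _).
by case: k i => [|k] [i lt_i] //=; rewrite subSS subKn.
Qed.

(** The geometric factorization of [z^k - h^k] exhibits the dividend as a
    multiple of the monic polynomial [z - h], so the division returns the
    other factor. *)
Lemma coef_div_diff (q : {poly R}) K n : (size q <= K)%N ->
  ((q^:P - (q \Po h)%:P) %/ ('X - h%:P))`_n
    = \sum_(k < K | (n < k)%N) q`_k *: h ^+ (k - n.+1).
Proof.
move=> leqK.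
have qE : q^:P = \sum_(k < K) (q`_k)%:P *: 'X^k.
  rewrite -(poly_def K (fun k => (q`_k)%:P)); apply/polyP=> k.
  rewrite coef_map_id0 // coef_poly; case: ltnP => // leKk.
  by rewrite nth_default // (leq_trans leqK).
have -> : q^:P - (q \Po h)%:P
    = (\sum_(k < K) (q`_k)%:P *: \poly_(i < k) h ^+ (k - i.+1)) * ('X - h%:P).
  rewrite qE (comp_poly_wide _ _ leqK) rmorph_sum /= -sumrB mulr_suml.
  apply: eq_bigr => k _; rewrite -scalerAl [_ * ('X - _)]mulrC -subXn_polyC.
  by rewrite scalerBr -mul_polyC polyCM mul_polyC.
rewrite Pdiv.IdomainMonic.mulpK ?monicXsubC // coef_sum [RHS]big_mkcond /=.
apply: eq_bigr => k _; rewrite coefZ coef_poly mul_polyC.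
by case: ltnP; rewrite ?scaler0.
Qed.

Lemma coef_associated V n :
  map_mx (coefp n) (associated h U V) =
  \sum_(k < mxpoly_size V | (n < k)%N)
     map_mx (coefp k) V *m vact U (h ^+ (k - n.+1) *: P0).
Proof.
rewrite /associated coef_vact_x.
have -> : map_mx (coefp n) (divided_diff V h *m map_mx polyC P0) =
  \sum_(k < mxpoly_size V | (n < k)%N)
     map_mx polyC (map_mx (coefp k) V) *m (h ^+ (k - n.+1) *: P0).
  apply/matrixP=> i j; rewrite summxE !mxE /= coef_sum.
  under [RHS]eq_bigr => k _ do rewrite mxE.
  rewrite exchange_big; apply: eq_bigr => l _ /=.
  rewrite !mxE coefMC (coef_div_diff _ _ _ (leq_mxpoly_size V i l)) mulr_suml.
  by apply: eq_bigr => k _; rewrite !mxE mulrA mul_polyC.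
by rewrite vact_sum; apply: eq_bigr => k _; rewrite vact_mulC.
Qed.

Lemma mul_markov_pos V n :
  mul_mxpoly_laurent V (markov h U) (Posz n) =
  laurent_of_mxpoly (associated h U V) (Posz n).
Proof.
rewrite /= coef_associated [RHS]big_mkcond; apply: eq_bigr => k _ /=.
case: ltnP => [ltnk|lekn]; last by rewrite subzn //= mulmx0.
suff -> : n%:Z - k%:Z = Negz (k - n.+1) by [].
by rewrite NegzE -subSn // subSS -subzn 1?ltnW // opprB.
Qed.

Lemma mul_markov_neg V n :
  mul_mxpoly_laurent V (markov h U) (Negz n) =
  vact U (h ^+ n *: (mx_comp V h *m P0)).
Proof.
rewrite mx_compE mulmx_suml scaler_sumr vact_sum; apply: eq_bigr => k _.
rewrite -mulmxA mul_scalar_mx scalemxAr vact_mulC scalerA -exprD.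
suff -> : Negz n - k%:Z = Negz (n + k) by [].
by rewrite !NegzE -opprD -PoszD addSn.
Qed.

(** The nonnegative powers of [z] cancel for every [V], so a condition on the
    leading term only constrains the moments [U(h^k V(h) P0)].  The shift by
    one comes from [z^(-k-1)] carrying the moment of order [k]. *)
Lemma leading_term_remainderP V n D :
  leading_term (sub_laurent (mul_mxpoly_laurent V (markov h U))
                            (laurent_of_mxpoly (associated h U V))) n.+1 D <->
  vact U (h ^+ n *: (mx_comp V h *m P0)) = D /\
  forall k, (k < n)%N -> vact U (h ^+ k *: (mx_comp V h *m P0)) = 0.
Proof.
rewrite /leading_term -NegzE /sub_laurent mul_markov_neg /= subr0.
split=> -[eD e0]; split=> //.
  by move=> k ltkn; have := e0 (Negz k); rewrite mul_markov_neg /= subr0; apply.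
case=> [k _|k lt_k]; first by rewrite mul_markov_pos subrr.
by rewrite mul_markov_neg subr0; apply: e0.
Qed.

(** [U(P0)] is the only block of the Hankel matrix of index [0], so it is the
    leading principal submatrix of order [N]. *)
Lemma vact_P0_unit : quasi_definite h U -> vact U P0 \in unitmx.
Proof.
move=> hU.
have le_N : (N <= \sum_(i < 1) N)%N by rewrite big_ord1.
have := hU 0%N N le_N.
suff -> : vact U P0 = leading_principal le_N (hankel h U 0) by [].
transitivity (submxblock (hankel h U 0) ord0 ord0).
  by rewrite mxblockK /Pvec expr0 scale1r.
have RankE (i : 'I_N) :
    tagnat.Rank (p_ := fun _ : 'I_1 => N) ord0 i = widen_ord le_N i.
  by apply/val_inj; rewrite [LHS]tagnat.RankEsum /= big_pred0_eq add0n.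
by apply/matrixP=> i j; rewrite [LHS]mxE !RankE [RHS]mxE.
Qed.

Lemma vact_vector_sequence0_unit (B : nat -> 'cV[{poly R}]_N) :
  quasi_definite h U -> vector_sequence B -> vact U (B 0%N) \in unitmx.
Proof.
move=> hU [p [size_p Bp]].
(* [B 0] lists [p_0], ..., [p_(N-1)], which span the same spaces as the
   monomials of [P0]; the change of basis is triangular since [deg p_i = i]. *)
pose L : 'M[R]_N := \matrix_(i, j) (p i)`_j.
have -> : B 0%N = map_mx polyC L *m P0.
  apply/matrixP=> i j; rewrite Bp !mxE mul0n add0n -[LHS]coefK poly_def.
  rewrite size_p (big_ord_widen N (fun k => (p i)`_k *: 'X^k)) // big_mkcond.
  apply: eq_bigr => k _; rewrite !mxE mul_polyC; case: ltnP => // lt_ik.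
  by rewrite nth_default ?scale0r // size_p.
rewrite vact_mulC unitmx_mul vact_P0_unit // andbT unitmxE unitfE det_trig.
  by apply/prodf_neq0 => i _; rewrite mxE -[i in _`_i]/(i.+1.-1) -(size_p i)
    -lead_coefE lead_coef_eq0 -size_poly_eq0 size_p.
by apply/is_trig_mxP=> i j lt_ij; rewrite mxE nth_default // size_p.
Qed.

End VectorAction.

Theorem theorem12 (R : realType) (N : nat) (hN : (0 < N)%N)
    (h : {poly R}) (hdeg : size h = N.+1)
    (U : 'I_N -> {scalar {poly R}}) (hU : quasi_definite h U)
    (B : nat -> 'cV[{poly R}]_N) (hB : vector_sequence B)
    (V : nat -> 'M[{poly R}]_N)
    (hV : forall m : nat, B m = mx_comp (V m) h *m P0) :
  left_orthogonal h U B <->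
  upper_triangular (vact U (B 0%N)) /\
  forall m : nat,
    exists D : 'M[R]_N,
      upper_triangular D /\ D \in unitmx /\
      leading_term
        (sub_laurent (mul_mxpoly_laurent (V m.+1) (markov h U))
                     (laurent_of_mxpoly (associated h U (V m.+1))))
        m.+2 D.
Proof.
split=> [orth|[upper0 lead] [|m]].
- split=> [|m].
    by have [_ []] := orth 0%N; rewrite expr0 scale1r.
  have [zero [upper unit]] := orth m.+1.
  exists (vact U (h ^+ m.+1 *: B m.+1)); do 2!split=> //.
  by apply/leading_term_remainderP; rewrite -hV.
- split=> //; rewrite expr0 scale1r; split=> //.
  exact: vact_vector_sequence0_unit hU hB.
- have [D [upper [unit /leading_term_remainderP]]] := lead m.
  by rewrite -hV => -[eD zero]; rewrite -eD in upper unit; split.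
Qed.
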